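(* Let $B_1,B_2$ be strongly semiprime skew left braces, let $\alpha:(B_2,\circ)\to\mathrm{Aut}(B_1,+,\circ)$ be a group homomorphism, and let $B:=B_1\rtimes_\alpha B_2$ be the semidirect product of $B_1$ and $B_2$ via $\alpha$. Then $B$ is a strongly semiprime skew left brace.
   Context: A skew left brace is a triple $(B,+,\circ)$ such that $(B,+)$ and $(B,\circ)$ are (not necessarily abelian) groups and $a\circ(b+c)=a\circ b-a+a\circ c$ for all $a,b,c\in B$. The two groups share the same identity, denoted $0$. For $a\in B$ put $\lambda_a(b):=-a+a\circ b$. An ideal of $B$ is a subset $I\subseteq B$ that is a normal subgroup of $(B,+)$, a normal subgroup of $(B,\circ)$, and satisfies $\lambda_a(I)\subseteq I$ for all $a\in B$. $\mathrm{Aut}(B,+,\circ)$ is the group of bijections of $B$ preserving both operations. Put $a*b:=-a+a\circ b-b$; for $X,Y\subseteq B$, $X*Y$ denotes the additive subgroup generated by all $x*y$ with $x\in X$, $y\in Y$. The operation $*$ on subsets is not associative in general; a $*$-product of copies of $I$ means any finite product formed from copies of $I$ using $*$, with any bracketing. $B$ is strongly semiprime if for each non-zero ideal $I$ of $B$ every $*$-product of copies of $I$ is non-zero (i.e. $\neq\{0\}$). The semidirect product $B_1\rtimes_\alpha B_2$ is the set $B_1\times B_2$ with operations $(a_1,a_2)+(b_1,b_2)=(a_1+b_1,a_2+b_2)$ and $(a_1,a_2)\circ(b_1,b_2)=(a_1\circ\alpha_{a_2}(b_1),a_2\circ b_2)$; it is a skew left brace. *)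

(* Defs.v *)
From HB Require Import structures.
From mathcomp Require Import all_boot.
From mathcomp Require Import boolp classical_sets.

Set Implicit Arguments.
Unset Strict Implicit.
Unset Printing Implicit Defensive.

Local Open Scope classical_set_scope.
Local Open Scope group_scope.

(* The group (B, o) is the groupType structure, written multiplicatively.      *)
(* The group (B, +) is not abelian in general, hence not a zmodType; its       *)
(* operations and laws are part of the mixin. The two neutral elements are a   *)
(* priori distinct; see braceE. The choiceType structure underlying groupType  *)
(* is no restriction classically, cf. gen_choiceMixin.                         *)
HB.mixin Record isSkewBrace B of Group B := {
  badd : B -> B -> B;
  bzero : B;
  bopp : B -> B;
  baddA : associative badd;
  badd0l : left_id bzero badd;
  badd0r : right_id bzero badd;
  baddNl : left_inverse bzero bopp badd;
  baddNr : right_inverse bzero bopp badd;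
  bmulD : forall a b c : B,
    a * badd b c = badd (badd (a * b) (bopp a)) (a * c)
}.

#[short(type="skewBraceType")]
HB.structure Definition SkewBrace := {B of isSkewBrace B & Group B}.

Declare Scope brace_scope.
Delimit Scope brace_scope with br.
Notation "0" := (@bzero _) : brace_scope.
Notation "x + y" := (badd x y) : brace_scope.
Notation "- x" := (bopp x) : brace_scope.
Notation "x - y" := (badd x (bopp y)) : brace_scope.
Local Open Scope brace_scope.

Lemma braceE (B : skewBraceType) : 0 = 1 :> B.
Proof.
have := bmulD (1 : B) 0 0; rewrite !mul1g badd0l badd0l badd0r => h.
by rewrite -[LHS](baddNl 1) -h badd0l.
Qed.

Section Ideals.
Variable B : skewBraceType.
Implicit Types (a b : B) (I X Y : set B).

Definition lambda a b : B := - a + a * b.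

Definition star a b : B := - a + a * b - b.

Definition is_subgroup (e : B) (op : B -> B -> B) (inv : B -> B) (H : set B) :=
  [/\ H e,
      (forall x y, H x -> H y -> H (op x y)) &
      (forall x, H x -> H (inv x))].

Definition is_normal_subgroup (e : B) (op : B -> B -> B) (inv : B -> B)
    (H : set B) :=
  is_subgroup e op inv H /\ (forall g x, H x -> H (op (op g x) (inv g))).

Definition is_add_subgroup : set B -> Prop :=
  is_subgroup 0 (@badd B) (@bopp B).

Definition ideal I :=
  [/\ is_normal_subgroup 0 (@badd B) (@bopp B) I,
      is_normal_subgroup 1 (@mul B) (@inv B) I &
      (forall a, lambda a @` I `<=` I)].

Definition set_star X Y : set B :=
  smallest is_add_subgroup [set star x y | x in X & y in Y].

(* Any bracketing is allowed; the product with the single factor I is included. *)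
Inductive star_product I : set B -> Prop :=
| star_product_single : star_product I I
| star_product_star X Y :
    star_product I X -> star_product I Y -> star_product I (set_star X Y).

End Ideals.

Definition strongly_semiprime (B : skewBraceType) :=
  forall I : set B, ideal I -> I <> [set 0] ->
  forall P : set B, star_product I P -> P <> [set 0].

(* The group Aut(B, +, o), with (f * g) x = f (g x). *)
Section Automorphisms.
Variable B : skewBraceType.

Record braceAut := BraceAut {
  aut_fun :> B -> B;
  aut_bij : bijective aut_fun;
  autD : {morph aut_fun : x y / x + y};
  autM : {morph aut_fun : x y / x * y}
}.

Lemma braceAut_eq (f g : braceAut) : f =1 g -> f = g.
Proof.
case: f g => [f f1 f2 f3] [g g1 g2 g3] /= /funext E.
by subst g; congr BraceAut; apply: Prop_irrelevance.
Qed.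

HB.instance Definition _ := gen_eqMixin braceAut.
HB.instance Definition _ := gen_choiceMixin braceAut.

Definition aut_one : braceAut :=
  @BraceAut id (Bijective (fun=> erefl) (fun=> erefl))
    (fun _ _ => erefl) (fun _ _ => erefl).

Lemma aut_mul_morphD (f g : braceAut) : {morph f \o g : x y / x + y}.
Proof. by move=> x y /=; rewrite !autD. Qed.

Lemma aut_mul_morphM (f g : braceAut) : {morph f \o g : x y / x * y}.
Proof. by move=> x y /=; rewrite !autM. Qed.

Definition aut_mul (f g : braceAut) : braceAut :=
  BraceAut (bij_comp (aut_bij f) (aut_bij g))
    (@aut_mul_morphD f g) (@aut_mul_morphM f g).

Lemma aut_inv_subproof (f : braceAut) :
  exists g : braceAut, cancel f g /\ cancel g f.
Proof.
have [g fK gK] := aut_bij f.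
have gD : {morph g : x y / x + y}.
  by move=> x y; apply: (can_inj fK); rewrite autD !gK.
have gM : {morph g : x y / x * y}.
  by move=> x y; apply: (can_inj fK); rewrite autM !gK.
by exists (BraceAut (Bijective gK fK) gD gM).
Qed.

Definition aut_inv (f : braceAut) : braceAut :=
  sval (cid (aut_inv_subproof f)).

Lemma autK (f : braceAut) : cancel f (aut_inv f).
Proof. by rewrite /aut_inv; case: cid => g []. Qed.

Lemma autVK (f : braceAut) : cancel (aut_inv f) f.
Proof. by rewrite /aut_inv; case: cid => g []. Qed.

Lemma aut_mulA : associative aut_mul.
Proof. by move=> f g h; apply: braceAut_eq. Qed.
Lemma aut_mul1 : left_id aut_one aut_mul.
Proof. by move=> f; apply: braceAut_eq. Qed.
Lemma aut_mulr1 : right_id aut_one aut_mul.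
Proof. by move=> f; apply: braceAut_eq. Qed.
Lemma aut_mulV : left_inverse aut_one aut_inv aut_mul.
Proof. by move=> f; apply: braceAut_eq => x; apply: autK. Qed.
Lemma aut_mulrV : right_inverse aut_one aut_inv aut_mul.
Proof. by move=> f; apply: braceAut_eq => x; apply: autVK. Qed.

HB.instance Definition _ :=
  isGroup.Build braceAut aut_mulA aut_mul1 aut_mulr1 aut_mulV aut_mulrV.

End Automorphisms.

(* The alias carries alpha, on which the multiplication depends, and hides the *)
(* componentwise structures of the pair type.                                  *)
Definition sdprod (B1 B2 : skewBraceType)
    (alpha : {multiplicative B2 -> braceAut B1}) : Type := (B1 * B2)%type.

Section SemidirectProduct.
Variables (B1 B2 : skewBraceType) (alpha : {multiplicative B2 -> braceAut B1}).
Local Notation B := (sdprod alpha).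

HB.instance Definition _ := Choice.copy B (B1 * B2)%type.

Definition sd_zero : B := (0, 0).
Definition sd_opp (a : B) : B := (- a.1, - a.2).
Definition sd_add (a b : B) : B := (a.1 + b.1, a.2 + b.2).
Definition sd_one : B := (1, 1).
Definition sd_inv (a : B) : B := (alpha a.2^-1 a.1^-1, a.2^-1).
Definition sd_mul (a b : B) : B := (a.1 * alpha a.2 b.1, a.2 * b.2).

Lemma alphaM x y b : alpha (x * y) b = alpha x (alpha y b).
Proof. by rewrite gmulfM. Qed.

Lemma alpha1 b : alpha 1 b = b.
Proof. by apply: (bij_inj (aut_bij (alpha 1))); rewrite -alphaM mulg1. Qed.

Lemma alpha_fix1 x : alpha x 1 = 1.
Proof. by apply: (mulgI (alpha x 1)); rewrite -autM !mulg1. Qed.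

Lemma sd_mulA : associative sd_mul.
Proof.
by move=> [a1 a2] [b1 b2] [c1 c2]; rewrite /sd_mul /= autM alphaM !mulgA.
Qed.
Lemma sd_mul1 : left_id sd_one sd_mul.
Proof. by move=> [a b]; rewrite /sd_mul /= alpha1 !mul1g. Qed.
Lemma sd_mulr1 : right_id sd_one sd_mul.
Proof. by move=> [a b]; rewrite /sd_mul /= alpha_fix1 !mulg1. Qed.
Lemma sd_mulV : left_inverse sd_one sd_inv sd_mul.
Proof. by move=> [a b]; rewrite /sd_mul /= -autM !mulVg alpha_fix1. Qed.
Lemma sd_mulrV : right_inverse sd_one sd_inv sd_mul.
Proof.
by move=> [a b]; rewrite /sd_mul /= -alphaM !mulgV alpha1 mulgV.
Qed.

HB.instance Definition _ :=
  isGroup.Build B sd_mulA sd_mul1 sd_mulr1 sd_mulV sd_mulrV.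

Lemma sd_addA : associative sd_add.
Proof.
by move=> [a1 a2] [b1 b2] [c1 c2]; congr pair; apply: baddA.
Qed.
Lemma sd_add0 : left_id sd_zero sd_add.
Proof. by move=> [a b]; congr pair; apply: badd0l. Qed.
Lemma sd_addr0 : right_id sd_zero sd_add.
Proof. by move=> [a b]; congr pair; apply: badd0r. Qed.
Lemma sd_addN : left_inverse sd_zero sd_opp sd_add.
Proof. by move=> [a b]; congr pair; apply: baddNl. Qed.
Lemma sd_addrN : right_inverse sd_zero sd_opp sd_add.
Proof. by move=> [a b]; congr pair; apply: baddNr. Qed.
Lemma sd_mulD (a b c : B) : 
  a * sd_add b c = sd_add (sd_add (a * b) (sd_opp a)) (a * c).
Proof.
case: a b c => [a1 a2] [b1 b2] [c1 c2]; congr pair => /=; last exact: bmulD.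
by rewrite autD; apply: bmulD.
Qed.

HB.instance Definition _ := isSkewBrace.Build B
  sd_addA sd_add0 sd_addr0 sd_addN sd_addrN sd_mulD.

End SemidirectProduct.

(* Main.v *)
Require Import Defs.
From mathcomp Require Import all_boot.
From mathcomp Require Import classical_sets.

(* Brace morphisms commute with the star product of subsets. An ideal I of the *)
(* semidirect product with non-zero projection to B2 is handled by projecting, *)
(* as its image is a non-zero ideal of B2. Otherwise I lies in the image of    *)
(* the inclusion of B1, and its preimage is a non-zero ideal of B1.            *)

Set Implicit Arguments.
Unset Strict Implicit.
Unset Printing Implicit Defensive.

Local Open Scope classical_set_scope.
Local Open Scope group_scope.
Local Open Scope brace_scope.

(** The key identity is f(X * Y) = f(X) * f(Y) for every brace morphism f ([image_set_star]), so
    bracketed products of I and of f(I) correspond ([star_product_image], [star_product_of_image]).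
    Suppose some product P of a non-zero ideal I vanishes. Its projection to B2 is a vanishing
    product of the ideal that I projects onto ([ideal_image]), so this ideal is zero. Then I is the
    image of an ideal J of B1 ([ideal_preimage]), and P is the image of a product Q of J. As B1
    embeds injectively, Q = 0, hence J = 0 and I = 0, a contradiction. *)

Lemma baddI (B : skewBraceType) (a : B) : injective (badd a).
Proof.
by move=> x y /(congr1 (badd (- a))); rewrite !baddA baddNl !badd0l.
Qed.

Section Morphism.
Variables (A B : skewBraceType) (f : A -> B).
Hypotheses (fD : {morph f : x y / x + y}) (fM : {morph f : x y / x * y}).

Lemma brace_morph0 : f 0 = 0.
Proof. by apply: (@baddI _ (f 0)); rewrite -fD !badd0r. Qed.

Lemma brace_morphN : {morph f : x / - x}.
Proof.
by move=> x; apply: (@baddI _ (f x)); rewrite -fD !baddNr brace_morph0.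
Qed.

Lemma brace_morph1 : f 1 = 1.
Proof. by rewrite -!braceE brace_morph0. Qed.

Lemma brace_morphV : {morph f : x / x^-1}.
Proof.
by move=> x; apply: (mulgI (f x)); rewrite -fM !mulgV brace_morph1.
Qed.

Lemma brace_morph_lambda : {morph f : x y / lambda x y}.
Proof. by move=> x y; rewrite /lambda fD brace_morphN fM. Qed.

Lemma brace_morph_star : {morph f : x y / star x y}.
Proof. by move=> x y; rewrite /star !fD !brace_morphN fM. Qed.

(** Both inclusions come from minimality of the generated subgroup, since preimages and images of
    additive subgroups under f are additive subgroups and f maps generators to generators. *)
Lemma image_set_star (X Y : set A) :
  f @` set_star X Y = set_star (f @` X) (f @` Y).
Proof.
apply/seteqP; split=> [_ [z Hz <-] G [[G0 GD GN] sG]|z Hz].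
  (* [G] is any additive subgroup containing the generators in the target; its preimage contains
     those in the source. *)
  apply: (Hz (f @^-1` G)); split; first split=> /= [|x y Gx Gy|x Gx].
  - by rewrite brace_morph0.
  - by rewrite fD; apply: GD.
  - by rewrite brace_morphN; apply: GN.
  move=> _ [x Xx] [y Yy] <- /=; rewrite brace_morph_star; apply: sG.
  by exists (f x); [exists x | exists (f y); [exists y|]].
apply: (Hz (f @` set_star X Y)).
split; first split=> [|_ _ [x Hx <-] [y Hy <-]|_ [x Hx <-]].
- by exists 0; [move=> G [[]] | exact: brace_morph0].
- exists (x + y); last exact: fD.
  by move=> G HG; have [[_ GD _] _] := HG; apply: GD; [apply: Hx|apply: Hy].
- exists (- x); last exact: brace_morphN.
  by move=> G HG; have [[_ _ GN] _] := HG; apply: GN; apply: Hx.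
move=> _ [_ [x Xx <-]] [_ [y Yy <-]] <-.
exists (star x y); last exact: brace_morph_star.
by move=> G [_]; apply; exists x => //; exists y.
Qed.

Lemma star_product_image (I P : set A) :
  star_product I P -> star_product (f @` I) (f @` P).
Proof.
elim=> [|X Y _ IX _ IY]; first exact: star_product_single.
by rewrite image_set_star; apply: star_product_star.
Qed.

(** The bracketing that builds [P] is replayed on [I]. This lifts a product along f, so that its
    vanishing can be pulled back when f is injective. *)
Lemma star_product_of_image (I : set A) (P : set B) :
  star_product (f @` I) P -> exists2 Q, star_product I Q & P = f @` Q.
Proof.
elim=> [|X Y _ [Q IQ ->] _ [R IR ->]].
  by exists I => //; exact: star_product_single.
by exists (set_star Q R); [exact: star_product_star | rewrite image_set_star].
Qed.

Lemma ideal_preimage (I : set B) : ideal I -> ideal (f @^-1` I).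
Proof.
move=> [[[I0 ID IN] Ic] [[I1 IM IV] Ij] Il]; split; first split; first split.
- by rewrite /= brace_morph0.
- by move=> x y /= Ix Iy; rewrite fD; apply: ID.
- by move=> x /= Ix; rewrite brace_morphN; apply: IN.
- by move=> g x /= Ix; rewrite !fD brace_morphN; apply: Ic.
- split; first split.
  + by rewrite /= brace_morph1.
  + by move=> x y /= Ix Iy; rewrite fM; apply: IM.
  + by move=> x /= Ix; rewrite brace_morphV; apply: IV.
  + by move=> g x /= Ix; rewrite !fM brace_morphV; apply: Ij.
- move=> a _ [x Ix <-] /=; rewrite brace_morph_lambda.
  by apply: (Il (f a)); exists (f x).
Qed.

(** Surjectivity lifts the conjugating elements and the index of [lambda] to [A], where closure of
    [I] applies. *)
Lemma ideal_image (I : set A) :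
  (forall y, exists x, f x = y) -> ideal I -> ideal (f @` I).
Proof.
move=> fS [[[I0 ID IN] Ic] [[I1 IM IV] Ij] Il]; split; first split; first split.
- by exists 0 => //; rewrite brace_morph0.
- by move=> _ _ [x Ix <-] [y Iy <-]; exists (x + y); [apply: ID | rewrite fD].
- by move=> _ [x Ix <-]; exists (- x); [apply: IN | rewrite brace_morphN].
- move=> g _ [x Ix <-]; have [h <-] := fS g.
  by exists (h + x - h); [apply: Ic | rewrite !fD brace_morphN].
- split; first split.
  + by exists 1 => //; rewrite brace_morph1.
  + by move=> _ _ [x Ix <-] [y Iy <-]; exists (x * y); [apply: IM | rewrite fM].
  + by move=> _ [x Ix <-]; exists x^-1; [apply: IV | rewrite brace_morphV].
  + move=> g _ [x Ix <-]; have [h <-] := fS g.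
    by exists (h * x * h^-1); [apply: Ij | rewrite !fM brace_morphV].
- move=> a _ [_ [x Ix <-] <-]; have [h <-] := fS a.
  exists (lambda h x); last exact: brace_morph_lambda.
  by apply: (Il h); exists x.
Qed.

End Morphism.

Section SemidirectProduct.
Variables (B1 B2 : skewBraceType) (alpha : {multiplicative B2 -> braceAut B1}).

Definition sd_inl (x : B1) : sdprod alpha := (x, 0).
Definition sd_snd (x : sdprod alpha) : B2 := x.2.

Lemma sd_inlD : {morph sd_inl : x y / x + y}.
Proof. by move=> x y; congr pair; rewrite /= badd0l. Qed.

(** The second component 0 is also the unit of the multiplicative group, so it acts trivially
    through [alpha]. *)
Lemma sd_inlM : {morph sd_inl : x y / x * y}.
Proof. by move=> x y; congr pair; rewrite /= braceE ?alpha1 ?mulg1. Qed.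

Lemma sd_sndD : {morph sd_snd : x y / x + y}.
Proof. by []. Qed.

Lemma sd_sndM : {morph sd_snd : x y / x * y}.
Proof. by []. Qed.

Lemma sd_snd_surj (y : B2) : exists x, sd_snd x = y.
Proof. by exists ((0, y) : sdprod alpha). Qed.

End SemidirectProduct.

Theorem corollary14 (B1 B2 : skewBraceType)
    (alpha : {multiplicative B2 -> braceAut B1})
    (hB1 : strongly_semiprime B1) (hB2 : strongly_semiprime B2) :
  strongly_semiprime (sdprod alpha).
Proof.
move=> I idI I_neq0 P IP P0.
have sndD := @sd_sndD _ _ alpha; have sndM := @sd_sndM _ _ alpha.
have inlD := @sd_inlD _ _ alpha; have inlM := @sd_inlM _ _ alpha.
have [I2_eq0|I2_neq0] := boolp.pselect (@sd_snd _ _ alpha @` I = [set 0]);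
  last first.
  apply: (hB2 _ (ideal_image sndD sndM (@sd_snd_surj _ _ alpha) idI) I2_neq0 _
    (star_product_image sndD sndM IP)).
  by rewrite P0 image_set1.
(* The projection of [I] is zero, so each element of [I] has the form (x, 0). *)
have I_inl : I = @sd_inl _ _ alpha @` (@sd_inl _ _ alpha @^-1` I).
  apply/seteqP; split=> [[x y] Ixy|_ [x Ix <-] //].
  have y0 : [set 0] y by rewrite -I2_eq0; exists (x, y).
  by exists x; rewrite /sd_inl /= -y0.
move: IP; rewrite I_inl => /(star_product_of_image inlD inlM)[Q IQ PQ].
apply: (hB1 _ (ideal_preimage inlD inlM idI) _ _ IQ) => [I1_eq0|].
  by apply: I_neq0; rewrite I_inl I1_eq0 image_set1.
(* [Q] vanishes since its image [P] does and the inclusion is injective; that [Q] contains 0 is also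
   read off from [P]. *)
apply/seteqP; split=> [x Qx|_ ->].
  have : P (sd_inl alpha x) by rewrite PQ; exists x.
  by rewrite P0 => -[].
have : P 0 by rewrite P0.
by rewrite PQ => -[x Qx [<-]].
Qed.
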